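(* Consider the composite problem, the Stochastic Decoupling Method and the gradient-estimator condition described in the context, with $f$ convex and $L$-smooth and $g_1,\dots,g_m,R$ proper closed convex. Take a gradient estimator that satisfies part (a) of the gradient-estimator condition with constants $\eta_0,\omega$ and sequence $\{\mathcal M^t\}$, a stepsize $\eta\le\eta_0$, and an optimum $x^*$ (with $y_1^*,\dots,y_m^*$) satisfying the optimality assumption. Then, with probability $1$, $D_f(x^t,x^* )\to0$ as $t\to\infty$.
   Context: Problem: $\min_{x\in\mathbb{R}^d}f(x)+\frac1m\sum_{j=1}^mg_j(x)+R(x)$ with $f:\mathbb{R}^d\to\mathbb{R}$ differentiable, convex and $L$-smooth ($f(x)\le f(y)+\langle\nabla f(y),x-y\rangle+\frac L2\|x-y\|^2$), minimizer set nonempty. $D_f(x,y):=f(x)-f(y)-\langle\nabla f(y),x-y\rangle$; $\mathrm{prox}_{\eta h}(x):=\arg\min_u\{h(u)+\frac1{2\eta}\|u-x\|^2\}$. Optimality assumption: $x^*$ is a minimizer and there are $y_j^*\in\partial g_j(x^* )$, $r^*\in\partial R(x^* )$ with $\nabla f(x^* )+\frac1m\sum_jy_j^*+r^*=0$. Stochastic Decoupling Method: stepsize $\eta>0$, probabilities $p_j>0$ summing to 1, $\eta_j:=\eta/(mp_j)$; deterministic start $x^0,y_1^0,\dots,y_m^0$, $y^0:=\frac1m\sum_jy_j^0$. For $t=0,1,\dots$: $v^t$ produced by a gradient estimator; $z^t=\mathrm{prox}_{\eta R}(x^t-\eta v^t-\eta y^t)$; draw $j$ with $\Pr(j=k)=p_k$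 independently of the past; $x^{t+1}=\mathrm{prox}_{\eta_jg_j}(z^t+\eta_jy_j^t)$; $y_j^{t+1}=y_j^t+\frac1{\eta_j}(z^t-x^{t+1})$, $y_k^{t+1}=y_k^t$ ($k\ne j$); $y^{t+1}=y^t+\frac1m(y_j^{t+1}-y_j^t)$. Gradient-estimator condition part (a): with $w^t:=x^t-\eta v^t$, $w^*:=x^*-\eta\nabla f(x^* )$, there are $\eta_0>0$, $\omega>0$ and a nonnegative sequence $\{\mathcal M^t\}$ such that for every $\eta\le\eta_0$ and all $t$: $\mathbb{E}\|w^t-w^*\|^2+\mathcal M^{t+1}\le\mathbb{E}\|x^t-x^*\|^2-\omega\eta\mathbb{E}D_f(x^t,x^* )+\mathcal M^t$. *)

(* Defs.v *)
From HB Require Import structures.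
From mathcomp Require Import all_boot all_order all_algebra.
From mathcomp Require Import all_classical all_reals all_analysis.
Set Implicit Arguments. Unset Strict Implicit. Unset Printing Implicit Defensive.
Import Order.TTheory GRing.Theory Num.Theory.
Import numFieldNormedType.Exports.
Local Open Scope classical_set_scope.
Local Open Scope ring_scope.

Section Defs.
Variables (R : realType) (d : nat).
Notation vec := 'rV[R]_d.

Definition dotv (u v : vec) : R := \sum_(i < d) u 0 i * v 0 i.
Definition sqnorm (u : vec) : R := dotv u u.

Definition has_gradient (f : vec -> R) (gradf : vec -> vec) : Prop :=
  forall x, differentiable f x /\ forall h, 'd f x h = dotv (gradf x) h.

Definition convex_fun (f : vec -> R) : Prop :=
  forall (x y : vec) (l : R), 0 <= l <= 1 ->
    f (l *: x + (1 - l) *: y) <= l * f x + (1 - l) * f y.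

Definition L_smooth (f : vec -> R) (gradf : vec -> vec) (L : R) : Prop :=
  forall x y, f x <= f y + dotv (gradf y) (x - y) + L / 2 * sqnorm (x - y).

Definition bregman (f : vec -> R) (gradf : vec -> vec) (x y : vec) : R :=
  f x - f y - dotv (gradf y) (x - y).

Definition proper_fun (g : vec -> \bar R) : Prop :=
  (forall x, g x != -oo%E) /\ exists x, g x \is a fin_num.
Definition convex_efun (g : vec -> \bar R) : Prop :=
  forall (x y : vec) (l : R), 0 <= l <= 1 ->
    (g (l *: x + (1 - l) *: y)%R <= l%:E * g x + (1 - l)%:E * g y)%E.
Definition proper_closed_convex (g : vec -> \bar R) : Prop :=
  [/\ proper_fun g, lower_semicontinuous g & convex_efun g].

Definition subgrad (g : vec -> \bar R) (x y : vec) : Prop :=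
  forall u, (g x + (dotv y (u - x)%R)%:E <= g u)%E.

Definition is_prox (h : vec -> \bar R) (eta : R) (a p : vec) : Prop :=
  forall u, (h p + (1 / (2 * eta) * sqnorm (p - a))%R%:E
             <= h u + (1 / (2 * eta) * sqnorm (u - a))%R%:E)%E.

Definition Fmeasurable_vec (dO : measure_display) (O : measurableType dO)
  (F : set (set O)) (X : O -> vec) : Prop :=
  forall (i : 'I_d) (B : set R), measurable B -> (fun w => X w 0 i) @^-1` B \in F.

End Defs.

Definition filtration (dO : measure_display) (O : measurableType dO)
  (F : nat -> set (set O)) : Prop :=
  forall t, [/\ sigma_algebra setT (F t), F t `<=` measurable & F t `<=` F t.+1].

(* Main.v *)
(* With u_k := y_k - y_k* and eta_k := eta / (m p_k), firm nonexpansiveness of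
   the proximal maps shows that, for each outcome j = k of the draw,
     |x^{t+1} - x*|^2 + sum_l eta_l^2 |u_l^{t+1}|^2
       <= |z - x*|^2 + 2 eta_k <z - x*, u_k> + sum_l eta_l^2 |u_l|^2.
   Since p_k eta_k = eta / m, averaging over k turns the cross term into
   2 eta <z - x*, y - y*>, and the prox step defining z bounds
   |z - x*|^2 + 2 eta <z - x*, y - y*> by |w - w*|^2.  Together with the
   estimator condition, E|x - x*|^2 + sum_l eta_l^2 E|u_l|^2 + M decreases by at
   least omega eta E D_f(x^t, x* ) at each step.  Hence
   sum_t E D_f(x^t, x* ) < oo, so sum_t D_f(x^t, x* ) < oo almost surely, and its
   nonnegative terms tend to 0. *)
Require Import Defs.
From HB Require Import structures.
From mathcomp Require Import all_boot all_order all_algebra.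
From mathcomp Require Import all_classical all_reals all_analysis.
From mathcomp Require Import measurable_realfun.
From mathcomp Require Import ring lra.
Set Implicit Arguments. Unset Strict Implicit. Unset Printing Implicit Defensive.
Import Order.TTheory GRing.Theory Num.Theory.
Import numFieldNormedType.Exports.
Local Open Scope classical_set_scope.
Local Open Scope ring_scope.

(** * Algebra of the inner product and the squared norm *)

Lemma dotvC (R : realType) (d : nat) (u v : 'rV[R]_d) : dotv u v = dotv v u.
Proof. by apply: eq_bigr => i _; rewrite mulrC. Qed.

Lemma dotvDl (R : realType) (d : nat) (u v w : 'rV[R]_d) :
  dotv (u + v) w = dotv u w + dotv v w.
Proof. by rewrite -big_split; apply: eq_bigr => i _ /=; rewrite mxE mulrDl. Qed.

Lemma dotvZl (R : realType) (d : nat) (a : R) (u v : 'rV[R]_d) :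
  dotv (a *: u) v = a * dotv u v.
Proof. by rewrite big_distrr; apply: eq_bigr => i _ /=; rewrite mxE mulrA. Qed.

Lemma dotvNl (R : realType) (d : nat) (u v : 'rV[R]_d) :
  dotv (- u) v = - dotv u v.
Proof. by rewrite -scaleN1r dotvZl mulN1r. Qed.

Lemma dotvDr (R : realType) (d : nat) (u v w : 'rV[R]_d) :
  dotv u (v + w) = dotv u v + dotv u w.
Proof. by rewrite dotvC dotvDl !(dotvC u). Qed.

Lemma dotvZr (R : realType) (d : nat) (a : R) (u v : 'rV[R]_d) :
  dotv u (a *: v) = a * dotv u v.
Proof. by rewrite dotvC dotvZl (dotvC u). Qed.

Lemma dotvNr (R : realType) (d : nat) (u v : 'rV[R]_d) :
  dotv u (- v) = - dotv u v.
Proof. by rewrite dotvC dotvNl (dotvC u). Qed.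

Definition dotvE := (dotvDl, dotvDr, dotvNl, dotvNr, dotvZl, dotvZr).

Lemma sqnorm_ge0 (R : realType) (d : nat) (u : 'rV[R]_d) : 0 <= sqnorm u.
Proof. by apply: sumr_ge0 => i _; rewrite -expr2 sqr_ge0. Qed.

Lemma sqnormD (R : realType) (d : nat) (u v : 'rV[R]_d) :
  sqnorm (u + v) = sqnorm u + 2 * dotv u v + sqnorm v.
Proof. rewrite /sqnorm !dotvE (dotvC v u); ring. Qed.

Lemma sqnormB (R : realType) (d : nat) (u v : 'rV[R]_d) :
  sqnorm (u - v) = sqnorm u - 2 * dotv u v + sqnorm v.
Proof. rewrite /sqnorm !dotvE (dotvC v u); ring. Qed.

Lemma sqnormZ (R : realType) (d : nat) (a : R) (u : 'rV[R]_d) :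
  sqnorm (a *: u) = a ^+ 2 * sqnorm u.
Proof. rewrite /sqnorm !dotvE; ring. Qed.

Lemma sqnorm_coord (R : realType) (d : nat) (u : 'rV[R]_d) (i : 'I_d) :
  u 0 i ^+ 2 <= sqnorm u.
Proof.
rewrite /sqnorm /dotv (bigD1 i) //= -expr2 lerDl.
by apply: sumr_ge0 => k _; rewrite -expr2 sqr_ge0.
Qed.

(** * Subgradients, proximal points and the Bregman distance *)

Lemma subgrad_fin_num (R : realType) (d : nat) (h : 'rV[R]_d -> \bar R)
    (x u : 'rV[R]_d) :
  proper_fun h -> subgrad h x u -> h x \is a fin_num.
Proof.
(* At a point [a] where [h] is finite, the subgradient inequality excludes [h x = +oo]. *)
move=> [hNy [a ha]] /(_ a); rewrite fin_numE hNy /=.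
by move: ha; case: (h a) => // r _; case: (h x).
Qed.

Lemma subgrad_monotone (R : realType) (d : nat) (h : 'rV[R]_d -> \bar R)
    (x y u v : 'rV[R]_d) :
  proper_fun h -> subgrad h x u -> subgrad h y v -> 0 <= dotv (u - v) (x - y).
Proof.
move=> hp hu hv.
have := subgrad_fin_num hp hu; have := subgrad_fin_num hp hv.
have := hu y; have := hv x.
case: (h x) => // a; case: (h y) => // b; rewrite -!EFinD !lee_fin => + + _ _.
rewrite !dotvE; lra.
Qed.

(** Optimality of [p] is tested at [l u + (1 - l) p]. Convexity bounds [h] there, and dividing by
    [l] leaves an error [l c |u - p|^2], which vanishes as [l] tends to 0. *)
Lemma prox_subgrad (R : realType) (d : nat) (h : 'rV[R]_d -> \bar R) (eta : R)
    (a p : 'rV[R]_d) :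
  proper_fun h -> convex_efun h -> 0 < eta -> is_prox h eta a p ->
  subgrad h p (eta^-1 *: (a - p)).
Proof.
move=> [hNy [b hb]] hconv eta0 hprox u.
have hpfin : h p \is a fin_num.
  rewrite fin_numE hNy /=; have := hprox b; move: hb.
  by case: (h b) => // r _; case: (h p).
have := hNy u; case hu : (h u) => [r| |] // _; last by rewrite leey.
move: hpfin; case hpp : (h p) => [s| |] // _.
rewrite -EFinD lee_fin dotvZl.
set c := 1 / (2 * eta).
have cE : eta^-1 = 2 * c by rewrite /c; field; rewrite gt_eqF.
have c0 : 0 < c by rewrite /c divr_gt0 // mulr_gt0.
rewrite cE.
set N := sqnorm (u - p); have N0 : 0 <= N := sqnorm_ge0 _.
have key l : 0 < l -> l <= 1 ->
    s <= r - 2 * c * dotv (a - p) (u - p) + l * (c * N).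
  move=> l0 l1.
  have := hprox (l *: u + (1 - l) *: p); rewrite -/c hpp => H1.
  have /hconv : 0 <= l <= 1 by rewrite (ltW l0) l1.
  move=> /(_ u p); rewrite hu hpp -!EFinM -EFinD => H2.
  have := le_trans H1 (leeD2r _ H2); rewrite -!EFinD lee_fin.
  have -> : l *: u + (1 - l) *: p - a = (p - a) + l *: (u - p).
    by apply/rowP => i; rewrite !mxE; ring.
  rewrite (sqnormD (p - a)) sqnormZ -/N dotvZr -(opprB a p) dotvNl.
  set D := dotv (a - p) (u - p) => H3.
  rewrite -(ler_pM2l l0); nra.
(* An error of at most [e] is reached with [l = 1] if [c * N < e], and otherwise with
   [l = e / (c * N)], which is then at most 1. *)
apply/ler_addgt0Pr => e e0.
have [N1|N1] := ltP (c * N) e.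
  by have := key 1 ltr01 (lexx 1); lra.
have cN0 : 0 < c * N by apply: lt_le_trans N1.
have /key : 0 < e / (c * N) by rewrite divr_gt0.
rewrite ler_pdivrMr // mul1r => /(_ N1).
by rewrite divfK ?gt_eqF //; lra.
Qed.

(** Firm nonexpansiveness, with [q] seen as the proximal point of [q + eta s]: monotonicity is
    applied to the subgradients [(a - p) / eta] at [p] and [s] at [q]. *)
Lemma prox_firm (R : realType) (d : nat) (h : 'rV[R]_d -> \bar R) (eta : R)
    (a p q s : 'rV[R]_d) :
  proper_fun h -> convex_efun h -> 0 < eta -> is_prox h eta a p ->
  subgrad h q s ->
  sqnorm (p - q) <= dotv (a - (q + eta *: s)) (p - q).
Proof.
move=> hp hc eta0 /(prox_subgrad hp hc eta0) hps hq.
have := subgrad_monotone hp hps hq.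
have -> : eta^-1 *: (a - p) - s =
    eta^-1 *: ((a - (q + eta *: s)) - (p - q)).
  apply/rowP => i; rewrite !mxE; field; by rewrite gt_eqF.
rewrite dotvZl pmulr_rge0 ?invr_gt0 // dotvDl dotvNl /sqnorm; lra.
Qed.

(** Expanding [|(a - b) - (p - q)|^2 >= 0] takes the place of Cauchy-Schwarz. *)
Lemma prox_nonexpansive (R : realType) (d : nat) (h : 'rV[R]_d -> \bar R)
    (eta : R) (a b p q : 'rV[R]_d) :
  proper_fun h -> convex_efun h -> 0 < eta ->
  is_prox h eta a p -> is_prox h eta b q ->
  sqnorm (p - q) <= sqnorm (a - b).
Proof.
move=> hp hc eta0 hpa hqb.
have := prox_firm hp hc eta0 hpa (prox_subgrad hp hc eta0 hqb).
rewrite scalerA divff ?gt_eqF // scale1r (addrC q) subrK.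
have := sqnorm_ge0 ((a - b) - (p - q)); rewrite sqnormB; lra.
Qed.

(** By convexity, the difference quotients of [f] from [y] towards [x] with step in [(0, 1]] are at
    most [f x - f y]; the gradient term is their right limit at 0. *)
Lemma bregman_ge0 (R : realType) (d : nat) (f : 'rV[R]_d -> R)
    (gradf : 'rV[R]_d -> 'rV[R]_d) (x y : 'rV[R]_d) :
  has_gradient f gradf -> convex_fun f -> 0 <= bregman f gradf x y.
Proof.
move=> /(_ y) [df dfE] fconv; rewrite /bregman -dfE -deriveE // subr_ge0.
have dv : derivable f y (x - y) by exact: diff_derivable.
have cv := cvg_dnbhs_at_right dv.
apply: (cvgr_to_le cv); near=> l.
have l0 : 0 < l by near: l; exact: nbhs_right_gt.
have l1 : l <= 1 by near: l; exact: nbhs_right_le.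
rewrite /= -[_ *: _]/(l^-1 * _) mulrC ler_pdivrMr //.
have /fconv : 0 <= l <= 1 by rewrite (ltW l0) l1.
move=> /(_ x y).
have -> : l *: x + (1 - l) *: y = l *: (x - y) + y.
  by apply/rowP => i; rewrite !mxE; ring.
lra.
Unshelve. all: by end_near. Qed.

(** * Measurability of vector-valued maps *)

Definition measurable_vec (R : realType) (d : nat) (dT : measure_display)
    (T : measurableType dT) (a : T -> 'rV[R]_d) : Prop :=
  forall i, measurable_fun setT (fun w => a w 0 i).

Lemma measurable_vec_cst (R : realType) (d : nat) (dT : measure_display)
    (T : measurableType dT) (u : 'rV[R]_d) :
  measurable_vec (fun _ : T => u).
Proof. by move=> i. Qed.

Lemma measurable_vecB (R : realType) (d : nat) (dT : measure_display)
    (T : measurableType dT) (a b : T -> 'rV[R]_d) :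
  measurable_vec a -> measurable_vec b -> measurable_vec (fun w => a w - b w).
Proof.
move=> ma mb i; under eq_fun do rewrite mxE mxE.
exact: measurable_funB.
Qed.

Lemma measurable_vecZ (R : realType) (d : nat) (dT : measure_display)
    (T : measurableType dT) (c : R) (a : T -> 'rV[R]_d) :
  measurable_vec a -> measurable_vec (fun w => c *: a w).
Proof.
move=> ma i; under eq_fun do rewrite mxE.
exact: measurable_funM.
Qed.

Lemma measurable_vec_sum (R : realType) (d : nat) (dT : measure_display)
    (T : measurableType dT) (m : nat) (a : 'I_m -> T -> 'rV[R]_d) :
  (forall k, measurable_vec (a k)) ->
  measurable_vec (fun w => \sum_(k < m) a k w).
Proof.
move=> ma i; under eq_fun do rewrite summxE.
by apply: measurable_sum => k; exact: ma.
Qed.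

(* A cube of side [1 / n] is coded by the integer parts of [n] times its
   coordinates, so open subsets of 'rV are countable unions of such cubes. *)
Lemma measurable_fun_lsc (R : realType) (d : nat) (dT : measure_display)
    (T : measurableType dT) (a : T -> 'rV[R]_d) (h : T -> R) :
  measurable_vec a ->
  (forall c w0, c < h w0 -> exists n : nat, forall w,
     (forall i, `|a w 0 i - a w0 0 i| < n.+1%:R^-1) -> c < h w) ->
  measurable_fun setT h.
Proof.
move=> ma hlsc mT; apply: (measurability _ (RGenOInfty.measurableE R)) => //.
move=> _ [_ [c ->] <-]; rewrite setTI preimage_itvoy.
pose cell (u : nat * {ffun 'I_d -> int}) : set T :=
  \bigcap_(i in [set: 'I_d])
    [set w | Num.floor (u.1.+1%:R * a w 0 i) = u.2 i].
have mcell u : measurable (cell u).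
  apply: fin_bigcap_measurable => // i _.
  have -> : [set w | Num.floor (u.1.+1%:R * a w 0 i) = u.2 i] =
      (fun w => u.1.+1%:R * a w 0 i) @^-1` `[(u.2 i)%:~R, (u.2 i + 1)%:~R[.
    by apply/seteqP; split => w /=; rewrite in_itv /= -floor_eq => /eqP.
  rewrite -[X in measurable X]setTI.
  have : measurable_fun setT (fun w => u.1.+1%:R * a w 0 i).
    exact: measurable_funM.
  by apply => //; exact: measurable_itv.
(* Cells not contained in the superlevel set are replaced by the empty set, so that the union runs
   over a whole countable type. *)
pose U u : set T := if `[< cell u `<=` [set w | c < h w] >] then cell u else set0.
have -> : [set w | c < h w] = \bigcup_u U u.
  apply/seteqP; split => [w0 /= cw0|w [u _]]; last first.
    by rewrite /U; case: asboolP => // sub /sub.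
  have [n hn] := hlsc _ _ cw0.
  pose q : {ffun 'I_d -> int} := [ffun i => Num.floor (n.+1%:R * a w0 0 i)].
  have w0q : cell (n, q) w0 by move=> i _ /=; rewrite ffunE.
  exists (n, q) => //; rewrite /U asboolT // => w wq; apply: hn => i.
  (* Equal integer parts put the coordinates, scaled by [n.+1], at distance less than 1. *)
  have := wq i Logic.I; rewrite /= ffunE => E.
  have := floor_itv (n.+1%:R * a w 0 i); have := floor_itv (n.+1%:R * a w0 0 i).
  rewrite E; set k := Num.floor _; rewrite intrD => /andP[A1 A2] /andP[A3 A4].
  rewrite -(ltr_pM2l (_ : 0 < n.+1%:R :> R)) // divff ?pnatr_eq0 //.
  by rewrite -[X in X * _]gtr0_norm // -normrM mulrBr ltr_norml; lra.
apply: countable_bigcupT_measurable => [|u]; first exact: countableP.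
by rewrite /U; case: ifP.
Qed.

Lemma measurable_fun_dotv (R : realType) (d : nat) (dT : measure_display)
    (T : measurableType dT) (a b : T -> 'rV[R]_d) :
  measurable_vec a ->
  measurable_vec b ->
  measurable_fun setT (fun w => dotv (a w) (b w)).
Proof. by move=> ma mb; apply: measurable_sum => i; exact: measurable_funM. Qed.

Lemma measurable_fun_continuous_comp (R : realType) (d : nat)
    (dT : measure_display) (T : measurableType dT) (f : 'rV[R]_d -> R)
    (a : T -> 'rV[R]_d) :
  continuous f -> measurable_vec a ->
  measurable_fun setT (fun w => f (a w)).
Proof.
move=> fc ma; apply: (measurable_fun_lsc ma) => c w0 cw0.
have /fc : nbhs (f (a w0)) [set r | c < r] by exact: lt_nbhsr.
move=> /nbhs_ballP[e /= e0 he].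
pose n := Num.truncn e^-1; exists n => w hw; apply: he.
have ne : n.+1%:R^-1 < e.
  rewrite -[ltRHS]invrK ltf_pV2 ?posrE ?invr_gt0 ?ltr0Sn //.
  by rewrite truncnS_gt.
split=> // i k; rewrite !ord1 /ball /= distrC.
exact: lt_trans ne.
Qed.

(** Nonexpansiveness makes every coordinate of [z] a Lipschitz function of [a], which meets the
    criterion of [measurable_fun_lsc]. *)
Lemma measurable_fun_prox (R : realType) (d : nat) (dT : measure_display)
    (T : measurableType dT) (h : 'rV[R]_d -> \bar R) (eta : R)
    (a z : T -> 'rV[R]_d) :
  proper_fun h -> convex_efun h -> 0 < eta ->
  (forall w, is_prox h eta (a w) (z w)) ->
  measurable_vec a ->
  measurable_vec z.
Proof.
move=> hp hc eta0 hz ma i; apply: (measurable_fun_lsc ma) => c w0 cw0.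
pose e := z w0 0 i - c; have e0 : 0 < e by rewrite subr_gt0.
(* With this [n] each coordinate moves by less than [e / d.+1], so the squared distance is at most
   [d (e / d.+1)^2]; taking [d.+1] rather than [d] keeps this strictly below [e^2]. *)
pose n := Num.truncn (d.+1%:R / e); exists n => w hw.
have de0 : 0 < d.+1%:R / e by rewrite divr_gt0.
have ne : n.+1%:R^-1 < e / d.+1%:R.
  rewrite -[ltRHS]invrK invf_div ltf_pV2 ?posrE ?ltr0Sn //.
  by rewrite truncnS_gt.
have : sqnorm (a w - a w0) <= d%:R * (e / d.+1%:R) ^+ 2.
  rewrite /sqnorm /dotv mulr_natl -[X in _ *+ X](card_ord d) -sumr_const.
  apply: ler_sum => k _; rewrite !mxE -expr2 -real_normK ?num_real //.
  by rewrite lerXn2r ?nnegrE ?normr_ge0 ?divr_ge0 ?(ltW e0) //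
     ltW // (lt_trans (hw k)).
move=> /(le_trans (prox_nonexpansive hp hc eta0 (hz w) (hz w0))).
move=> /(le_trans (sqnorm_coord _ i)); rewrite !mxE => H.
have : (z w 0 i - z w0 0 i) ^+ 2 < e ^+ 2.
  apply: le_lt_trans H _; rewrite expr_div_n mulrCA gtr_pMr ?exprn_gt0 //.
  by rewrite ltr_pdivrMr ?exprn_gt0 // mul1r -natrX ltr_nat -mulnn leq_pmulr.
by rewrite -(real_normK (num_real _)) ltr_sqr ?nnegrE ?normr_ge0 ?(ltW e0) //
   ltr_norml => /andP[]; rewrite /e; lra.
Qed.

(** * From summable expectations to almost sure convergence *)

Lemma ae_cvg0_of_sum_integral_le (R : realType) (dT : measure_display)
    (T : measurableType dT) (P : {measure set T -> \bar R})
    (D : nat -> T -> R) (K : R) :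
  (forall t, measurable_fun setT (D t)) -> (forall t w, 0 <= D t w) ->
  (forall n, (\sum_(t < n) \int[P]_w (D t w)%:E <= K%:E)%E) ->
  {ae P, forall w, D ^~ w @ \oo --> (0 : R)}.
Proof.
move=> mD D0 hK.
have mE t : measurable_fun setT (fun w => (D t w)%:E) by exact/measurable_EFinP.
have E0 t w : setT w -> (0 <= (D t w)%:E)%E by rewrite lee_fin.
pose S w := (\sum_(0 <= t <oo) (D t w)%:E)%E.
have S0 w : (0 <= S w)%E by apply: nneseries_ge0 => t _ _; exact: E0.
have iS : P.-integrable setT S.
  apply/integrableP; split; first by apply: ge0_emeasurable_sum => // *; exact: E0.
  under eq_integral do rewrite gee0_abs //.
  rewrite (integral_nneseries P measurableT mE E0).
  apply: le_lt_trans (ltry K); apply: lime_le.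
    by apply: is_cvg_nneseries => t _ _; apply: integral_ge0 => w; exact: E0.
  by apply: nearW => n; rewrite big_mkord.
have := integrable_ae measurableT iS; apply: filterS => w /(_ Logic.I).
move=> Sfin.
apply: cvg_series_cvg_0; apply: nondecreasing_is_cvgn.
  by apply: nondecreasing_series => t _ _; exact: D0.
exists (fine (S w)) => _ [n _ <-]; rewrite /series /= -lee_fin -sumEFin fineK //.
by apply: nneseries_lim_ge => t _ _; exact: E0.
Qed.

(** * Integration and independence relative to a sub-sigma-algebra *)

Lemma g_sigma_measurableP (dT : measure_display) (T : measurableType dT)
    (G : set (set T)) (A : set T) :
  sigma_algebra setT G -> G.-sigma.-measurable A <-> G A.
Proof. by move=> /measurable_g_measurableTypeE ->. Qed.

Lemma measurable_fun_g_sigma (d1 d2 : measure_display) (T : measurableType d1)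
    (T' : measurableType d2) (G : set (set T)) (h : T -> T') :
  sigma_algebra setT G -> G `<=` measurable ->
  measurable_fun (setT : set (g_sigma_algebraType G)) h ->
  measurable_fun (setT : set T) h.
Proof.
move=> sG Gm mh _ B mB; apply: Gm; apply/(g_sigma_measurableP _ sG).
exact: mh measurableT B mB.
Qed.

Lemma Fmeasurable_vec_g_sigma (R : realType) (d : nat) (dT : measure_display)
    (T : measurableType dT) (G : set (set T)) (X : T -> 'rV[R]_d) :
  sigma_algebra setT G -> Fmeasurable_vec G X ->
  measurable_vec (X : g_sigma_algebraType G -> 'rV[R]_d).
Proof.
move=> sG mX i _ B mB; rewrite setTI; apply/(g_sigma_measurableP _ sG).
by have := mX i B mB; rewrite inE.
Qed.

(** The measures [A -> P (A & E)] and [p P] coincide on [G], hence give the same integral to every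
    nonnegative [G]-measurable function. *)
Lemma integral_indep_event (R : realType) (dT : measure_display)
    (T : measurableType dT) (P : probability T R) (G : set (set T))
    (E : set T) (p : R) (h : T -> \bar R) :
  sigma_algebra setT G -> G `<=` measurable -> measurable E -> 0 <= p ->
  (forall A, A \in G -> P (A `&` E) = (p%:E * P A)%E) ->
  measurable_fun (setT : set (g_sigma_algebraType G)) h ->
  (forall w, (0 <= h w)%E) ->
  (\int[P]_(w in E) h w = p%:E * \int[P]_w h w)%E.
Proof.
move=> sG Gm mE p0 PE mh h0.
(* Pushing a measure forward along this identity map restricts it to [G]. *)
pose i : T -> g_sigma_algebraType G := id.
have mi : measurable_fun setT i.
  by move=> _ B /(g_sigma_measurableP _ sG) /Gm mB; rewrite setTI.
have mhT : measurable_fun (setT : set T) h := measurable_fun_g_sigma sG Gm mh.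
pose PEm : {measure set T -> \bar R} := mrestr P mE.
have -> : (\int[P]_(w in E) h w = \int[PEm]_w h w)%E.
  rewrite -(setUv E) ge0_integral_setU //; last 3 first.
  - exact: measurableC.
  - by rewrite setUv.
  - by rewrite disj_set2E setICr.
  rewrite [X in (_ + X)%E]null_set_integral ?adde0; last 3 first.
  - exact: measurableC.
  - exact: measurable_funTS.
  - by rewrite /PEm /= /mrestr setICl measure0.
  by apply: eq_measure_integral => A mA AE; rewrite /PEm /= /mrestr setIidl.
have -> : (\int[PEm]_w h w = \int[pushforward PEm i]_w h w)%E.
  by rewrite ge0_integral_pushforward.
have -> : (\int[P]_w h w = \int[pushforward P i]_w h w)%E.
  by rewrite ge0_integral_pushforward.
pose pn : {nonneg R} := NngNum p0.
rewrite -[p]/(pn%:num) -ge0_integral_mscale //.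
apply: eq_measure_integral => A /(g_sigma_measurableP _ sG) GA _.
by rewrite /= /mscale /pushforward /PEm /mrestr PE // inE.
Qed.

(** Stands in for conditioning on the past [G]: [Omega] is split by the value of [j], and on each
    piece [H] is replaced by the [G]-measurable bound [h k], to which independence applies. [H]
    itself may depend on the draw. *)
Lemma le_integral_indep_choice (R : realType) (dT : measure_display)
    (T : measurableType dT) (P : probability T R) (G : set (set T)) (m : nat)
    (j : T -> 'I_m) (p : 'I_m -> R) (H : T -> R) (h : 'I_m -> T -> R) :
  sigma_algebra setT G -> G `<=` measurable ->
  (forall k, measurable [set w | j w = k]) -> (forall k, 0 <= p k) ->
  (forall k A, A \in G -> P (A `&` [set w | j w = k]) = ((p k)%:E * P A)%E) ->
  measurable_fun (setT : set T) H -> (forall w, 0 <= H w) ->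
  (forall k, measurable_fun (setT : set (g_sigma_algebraType G)) (h k)) ->
  (forall k w, 0 <= h k w) -> (forall w, H w <= h (j w) w) ->
  (\int[P]_w (H w)%:E <= \int[P]_w (\sum_(k < m) p k * h k w)%:E)%E.
Proof.
move=> sG Gm mj p0 Pj mH H0 mh h0 Hh.
have mhT k := measurable_fun_g_sigma sG Gm (mh k).
have mEH : measurable_fun setT (EFin \o H) by exact/measurable_EFinP.
have mEh k : measurable_fun setT (EFin \o h k) by exact/measurable_EFinP.
have jT : setT = \big[setU/set0]_(k <- index_enum 'I_m) [set w | j w = k].
  rewrite -bigcup_seq; apply/seteqP; split=> // w _.
  by exists (j w) => //=; rewrite mem_index_enum.
rewrite {1}jT ge0_integral_bigsetU //=; last 4 first.
- exact: index_enum_uniq.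
- by move=> k l _ _ [w [/= <- <-]].
- by rewrite -jT.
- by move=> w _; rewrite lee_fin.
under [leRHS]eq_integral do rewrite -sumEFin.
rewrite ge0_integral_sum //=; last 2 first.
- move=> k; apply/measurable_EFinP; exact: measurable_funM.
- by move=> k w _; rewrite lee_fin mulr_ge0.
apply: lee_sum => k _.
under [leRHS]eq_integral do rewrite EFinM.
have hE0 w : (0 <= (h k w)%:E)%E by rewrite lee_fin.
have mE : measurable_fun (setT : set (g_sigma_algebraType G)) (EFin \o h k).
  exact/measurable_EFinP.
rewrite ge0_integralZl //; [|exact: mEh|by rewrite lee_fin].
rewrite -(integral_indep_event sG Gm (mj k) (p0 k) (Pj k) mE hE0).
apply: ge0_le_integral => //.
- by move=> w _; rewrite lee_fin.
- exact: measurable_funTS.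
- exact: measurable_funTS.
- by move=> w /= <-; rewrite lee_fin.
Qed.

(** * One-step inequalities for the proximal updates *)

Lemma prox_dual_step (R : realType) (d : nat) (g : 'rV[R]_d -> \bar R) (c : R)
    (xs ys z x y : 'rV[R]_d) :
  proper_fun g -> convex_efun g -> 0 < c -> subgrad g xs ys ->
  is_prox g c (z + c *: y) x ->
  sqnorm (x - xs) + c ^+ 2 * sqnorm (y + c^-1 *: (z - x) - ys) <=
  sqnorm (z - xs + c *: (y - ys)).
Proof.
move=> gp gc c0 hys /(prox_firm gp gc c0) /(_ hys).
have -> : z + c *: y - (xs + c *: ys) = z - xs + c *: (y - ys).
  by apply/rowP => i; rewrite !mxE; ring.
rewrite -sqnormZ.
(* The new scaled dual error is [a - b], where [a = z - xs + c (y - ys)] and [b = x - xs]. The firm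
   inequality [|b|^2 <= <a, b>] then gives [|b|^2 + |a - b|^2 <= |a|^2]. *)
have -> : c *: (y + c^-1 *: (z - x) - ys) =
    (z - xs + c *: (y - ys)) - (x - xs).
  by apply/rowP => i; rewrite !mxE; field; rewrite gt_eqF.
rewrite (sqnormB (_ + _) (x - xs)); lra.
Qed.

(** By [hopt], [xs + eta rs] is [(xs - eta gs) - eta ys]. With [a = w - (xs - eta gs)] and
    [b = z - xs], doubling the firm inequality bounds the left side by [2 <a, b> - |b|^2], hence by
    [|a|^2]. *)
Lemma prox_forward_step (R : realType) (d : nat) (h : 'rV[R]_d -> \bar R)
    (eta : R) (xs gs ys rs w y z : 'rV[R]_d) :
  proper_fun h -> convex_efun h -> 0 < eta -> subgrad h xs rs ->
  gs + ys + rs = 0 -> is_prox h eta (w - eta *: y) z ->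
  sqnorm (z - xs) + 2 * eta * dotv (z - xs) (y - ys) <=
  sqnorm (w - (xs - eta *: gs)).
Proof.
move=> hp hc eta0 hrs hopt /(prox_firm hp hc eta0) /(_ hrs).
have -> : w - eta *: y - (xs + eta *: rs) =
    w - (xs - eta *: gs) - eta *: (y - ys).
  have -> : rs = - (gs + ys) by apply/eqP; rewrite -addr_eq0 addrC hopt.
  by apply/rowP => i; rewrite !mxE; ring.
set a := w - _; rewrite dotvDl dotvNl dotvZl (dotvC (y - ys)).
by have := sqnorm_ge0 (a - (z - xs)); rewrite sqnormB; lra.
Qed.

(** * The potential function, its expected descent and the almost sure limit *)

Theorem theorem9
  (R : realType) (d m : nat) (hm : (0 < m)%N)
  (* problem data *)
  (f : 'rV[R]_d -> R) (gradf : 'rV[R]_d -> 'rV[R]_d) (L : R)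
  (g : 'I_m -> 'rV[R]_d -> \bar R) (Rf : 'rV[R]_d -> \bar R)
  (hfgrad : has_gradient f gradf) (hfconv : convex_fun f)
  (hfsmooth : L_smooth f gradf L)
  (hg : forall k, proper_closed_convex (g k)) (hR : proper_closed_convex Rf)
  (* optimum *)
  (xs : 'rV[R]_d) (ys : 'I_m -> 'rV[R]_d) (rs : 'rV[R]_d)
  (hmin : forall x : 'rV[R]_d,
     ((f xs)%:E + (1 / m%:R)%:E * (\sum_(k < m) g k xs) + Rf xs
      <= (f x)%:E + (1 / m%:R)%:E * (\sum_(k < m) g k x) + Rf x)%E)
  (hys : forall k, subgrad (g k) xs (ys k)) (hrs : subgrad Rf xs rs)
  (hopt : gradf xs + (1 / m%:R) *: (\sum_(k < m) ys k) + rs = 0)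
  (* method parameters *)
  (eta : R) (heta : 0 < eta) (p : 'I_m -> R) (hp : forall k, 0 < p k)
  (hp1 : \sum_(k < m) p k = 1)
  (* probability space and filtration ("the past") *)
  (dO : measure_display) (Omega : measurableType dO) (P : probability Omega R)
  (F : nat -> set (set Omega)) (hF : filtration F)
  (* iterates *)
  (x : nat -> Omega -> 'rV[R]_d) (y : nat -> 'I_m -> Omega -> 'rV[R]_d)
  (ybar : nat -> Omega -> 'rV[R]_d)
  (v z : nat -> Omega -> 'rV[R]_d) (j : nat -> Omega -> 'I_m)
  (x0 : 'rV[R]_d) (y0 : 'I_m -> 'rV[R]_d)
  (hx0 : forall w, x 0%N w = x0) (hy0 : forall k w, y 0%N k w = y0 k)
  (hybar0 : forall w, ybar 0%N w = (1 / m%:R) *: \sum_(k < m) y0 k)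
  (hz : forall t w, is_prox Rf eta (x t w - eta *: v t w - eta *: ybar t w) (z t w))
  (hx : forall t w, is_prox (g (j t w)) (eta / (m%:R * p (j t w)))
          (z t w + (eta / (m%:R * p (j t w))) *: y t (j t w) w) (x t.+1 w))
  (hy : forall t k w, y t.+1 k w =
          if k == j t w then
            y t k w + ((eta / (m%:R * p k))^-1) *: (z t w - x t.+1 w)
          else y t k w)
  (hybar : forall t w, ybar t.+1 w =
          ybar t w + (1 / m%:R) *: (y t.+1 (j t w) w - y t (j t w) w))
  (* measurability with respect to the past *)
  (hxm : forall t, Fmeasurable_vec (F t) (x t))
  (hym : forall t k, Fmeasurable_vec (F t) (y t k))
  (hvm : forall t, Fmeasurable_vec (F t) (v t))
  (* j_t is drawn with Pr(j_t = k) = p_k independently of the past *)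
  (hjm : forall t k, [set w | j t w = k] \in F t.+1)
  (hjind : forall t k A, A \in F t ->
     (P (A `&` [set w | j t w = k]) = (p k)%:E * P A)%E)
  (* gradient-estimator condition, part (a) *)
  (eta0 omega : R) (heta0 : 0 < eta0) (homega : 0 < omega)
  (M : nat -> R) (hM : forall t, 0 <= M t) (hetale : eta <= eta0)
  (hA : forall t : nat,
     (\int[P]_w (sqnorm ((x t w - eta *: v t w) - (xs - eta *: gradf xs)))%:E
      + (M t.+1)%:E
      + (omega * eta)%:E * \int[P]_w (bregman f gradf (x t w) xs)%:E
      <= \int[P]_w (sqnorm (x t w - xs))%:E + (M t)%:E)%E) :
  {ae P, forall w, (fun t => bregman f gradf (x t w) xs) @ \oo --> (0 : R)}.
Proof.
have m0 : 0 < m%:R :> R by rewrite ltr0n.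
have hpr k : proper_fun (g k) by case: (hg k).
have hcv k : convex_efun (g k) by case: (hg k).
have [Rpr _ Rcv] := hR.
have sF t : sigma_algebra setT (F t) by case: (hF t).
have Fm t : F t `<=` measurable by case: (hF t).
pose ek k := eta / (m%:R * p k).
have ek0 k : 0 < ek k by rewrite divr_gt0 // mulr_gt0.
have pek k : p k * ek k = eta / m%:R.
  by rewrite /ek; field; rewrite !gt_eqF.
(* The incremental update preserves the average because only the drawn index changes; measurability
   of [ybar t] is later read off this formula. *)
have ybarE t w : ybar t w = (1 / m%:R) *: \sum_(k < m) y t k w.
  elim: t => [|t IH].
    by rewrite hybar0; congr (_ *: _); apply: eq_bigr => k _; rewrite hy0.
  rewrite hybar IH -scalerDr; congr (_ *: _).
  rewrite (bigD1 (j t w)) // [RHS](bigD1 (j t w)) //=.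
  rewrite [in RHS](eq_bigr (fun k => y t k w)); last first.
    by move=> k /negbTE kj; rewrite hy kj.
  by rewrite addrAC (addrC (y t (j t w) w)) subrK.
pose ysbar := (1 / m%:R) *: \sum_(k < m) ys k.
pose Y t w := \sum_(k < m) ek k ^+ 2 * sqnorm (y t k w - ys k).
have Y0 t w : 0 <= Y t w.
  by apply: sumr_ge0 => k _; rewrite mulr_ge0 ?sqr_ge0 ?sqnorm_ge0.
have YD1 t w k : Y t w = ek k ^+ 2 * sqnorm (y t k w - ys k) +
    \sum_(l < m | l != k) ek l ^+ 2 * sqnorm (y t l w - ys l).
  by rewrite /Y (bigD1 k).
pose H t w := sqnorm (x t w - xs) + Y t w.
(* [h t k] bounds the next potential [H t.+1] when [k] is drawn, using only quantities known before
   the draw. Completing the square in [hE] shows that it is nonnegative. *)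
pose h t k w := sqnorm (z t w - xs) +
  2 * ek k * dotv (z t w - xs) (y t k w - ys k) + Y t w.
pose W t w := sqnorm (x t w - eta *: v t w - (xs - eta *: gradf xs)).
have hE t k w : h t k w =
    sqnorm (z t w - xs + ek k *: (y t k w - ys k)) +
    \sum_(l < m | l != k) ek l ^+ 2 * sqnorm (y t l w - ys l).
  by rewrite /h (YD1 t w k) (sqnormD (z t w - xs)) dotvZr sqnormZ; ring.
have h0 t k w : 0 <= h t k w.
  rewrite hE addr_ge0 ?sqnorm_ge0 ?sumr_ge0 // => l _.
  by rewrite mulr_ge0 ?sqr_ge0 ?sqnorm_ge0.
have Hh t w : H t.+1 w <= h t (j t w) w.
  rewrite hE /H (YD1 t.+1 w (j t w)) addrA.
  rewrite [X in _ + _ + X](eq_bigr (fun l =>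
      ek l ^+ 2 * sqnorm (y t l w - ys l))); last first.
    by move=> l /negbTE lj; rewrite hy lj.
  rewrite lerD2r hy eqxx.
  exact: prox_dual_step (hpr _) (hcv _) (ek0 _) (hys _) (hx t w).
have sumh t w : \sum_(k < m) p k * h t k w <= W t w + Y t w.
  have -> : \sum_(k < m) p k * h t k w = sqnorm (z t w - xs) +
      2 * eta * dotv (z t w - xs) (ybar t w - ysbar) + Y t w.
    rewrite ybarE -scalerBr -sumrB dotvZr.
    have -> : dotv (z t w - xs) (\sum_(k < m) (y t k w - ys k)) =
        \sum_(k < m) dotv (z t w - xs) (y t k w - ys k).
      rewrite /dotv exchange_big; apply: eq_bigr => i _ /=.
      by rewrite summxE big_distrr.
    rewrite (eq_bigr (fun k => p k * (sqnorm (z t w - xs) + Y t w) +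
        2 * (eta / m%:R) * dotv (z t w - xs) (y t k w - ys k))); last first.
      by move=> k _; rewrite -(pek k) /h; ring.
    rewrite big_split -big_distrl hp1 -big_distrr /=; ring.
  rewrite lerD2r.
  exact: prox_forward_step Rpr Rcv heta hrs hopt (hz t w).
have mx t := Fmeasurable_vec_g_sigma (sF t) (hxm t).
have my t k := Fmeasurable_vec_g_sigma (sF t) (hym t k).
have mv t := Fmeasurable_vec_g_sigma (sF t) (hvm t).
(* [z t] is a function of the past only, so it is independent of [j t]. *)
have mz t : measurable_vec (z t : g_sigma_algebraType (F t) -> _).
  apply: (@measurable_fun_prox _ _ _ (g_sigma_algebraType (F t)) _ _ _ _
    Rpr Rcv heta (hz t)).
  apply: measurable_vecB.
    by apply: measurable_vecB; [exact: mx|apply: measurable_vecZ; exact: mv].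
  apply: measurable_vecZ => i; under eq_fun do rewrite ybarE.
  apply: measurable_vecZ; apply: measurable_vec_sum => k; exact: my.
have mY t : measurable_fun (setT : set (g_sigma_algebraType (F t))) (Y t).
  apply: measurable_sum => k; apply: measurable_funM => //.
  by apply: measurable_fun_dotv; apply: measurable_vecB;
    [exact: my|exact: measurable_vec_cst|exact: my|exact: measurable_vec_cst].
have mxs t : measurable_fun (setT : set (g_sigma_algebraType (F t)))
    (fun w => sqnorm (x t w - xs)).
  by apply: measurable_fun_dotv; apply: measurable_vecB;
    [exact: mx|exact: measurable_vec_cst|exact: mx|exact: measurable_vec_cst].
have mh t k : measurable_fun (setT : set (g_sigma_algebraType (F t))) (h t k).
  have mzs : measurable_vec (fun w : g_sigma_algebraType (F t) => z t w - xs).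
    by apply: measurable_vecB; [exact: mz|exact: measurable_vec_cst].
  apply: measurable_funD; last exact: mY.
  apply: measurable_funD; first exact: measurable_fun_dotv.
  apply: measurable_funM => //; apply: measurable_fun_dotv => //.
  by apply: measurable_vecB; [exact: my|exact: measurable_vec_cst].
have mW t : measurable_fun (setT : set (g_sigma_algebraType (F t))) (W t).
  have mw : measurable_vec (fun w : g_sigma_algebraType (F t) =>
      x t w - eta *: v t w - (xs - eta *: gradf xs)).
    apply: measurable_vecB; last exact: measurable_vec_cst.
    by apply: measurable_vecB; [exact: mx|apply: measurable_vecZ; exact: mv].
  exact: measurable_fun_dotv.
pose D t w := bregman f gradf (x t w) xs.
have D0 t w : 0 <= D t w by exact: bregman_ge0.
have mD t : measurable_fun (setT : set (g_sigma_algebraType (F t))) (D t).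
  apply: measurable_funB.
    apply: measurable_funB => //; apply: measurable_fun_continuous_comp => //.
    by move=> u; apply: differentiable_continuous; case: (hfgrad u).
  apply: measurable_fun_dotv; first exact: measurable_vec_cst.
  by apply: measurable_vecB; [exact: mx|exact: measurable_vec_cst].
have intD t (h1 h2 : Omega -> R) :
    measurable_fun (setT : set (g_sigma_algebraType (F t))) h1 ->
    measurable_fun (setT : set (g_sigma_algebraType (F t))) h2 ->
    (forall w, 0 <= h1 w) -> (forall w, 0 <= h2 w) ->
    (\int[P]_w (h1 w + h2 w)%:E =
     \int[P]_w (h1 w)%:E + \int[P]_w (h2 w)%:E)%E.
  move=> /(measurable_fun_g_sigma (sF t) (@Fm t)) mh1.
  move=> /(measurable_fun_g_sigma (sF t) (@Fm t)) mh2 h10 h20.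
  under eq_integral do rewrite EFinD.
  rewrite ge0_integralD //; try by move=> w _; rewrite lee_fin.
  - exact/measurable_EFinP.
  - exact/measurable_EFinP.
have mj t k : measurable [set w | j t w = k].
  by have := hjm t k; rewrite inE => /Fm.
(* Integrability is not known at this stage, so the inequalities stay additive in the extended reals
   and nothing is subtracted. *)
have step t : (\int[P]_w (sqnorm (x t.+1 w - xs))%:E +
    \int[P]_w (Y t.+1 w)%:E <= \int[P]_w (W t w)%:E + \int[P]_w (Y t w)%:E)%E.
  rewrite -(intD t.+1) ?mxs ?mY //; last by move=> w; exact: sqnorm_ge0.
  rewrite -(intD t) ?mW ?mY //; last by move=> w; exact: sqnorm_ge0.
  have mH : measurable_fun setT (H t.+1).
    apply: (measurable_fun_g_sigma (sF t.+1) (@Fm t.+1)).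
    exact: measurable_funD.
  have H0 w : 0 <= H t.+1 w by rewrite addr_ge0 ?sqnorm_ge0.
  apply: le_trans (le_integral_indep_choice (sF t) (@Fm t) (mj t)
    (fun k => ltW (hp k)) (hjind t) mH H0 (mh t) (h0 t) (Hh t)) _.
  apply: ge0_le_integral => //.
  - by move=> w _; rewrite lee_fin sumr_ge0 // => k _; rewrite mulr_ge0 // ltW.
  - apply/measurable_EFinP; apply: (measurable_fun_g_sigma (sF t) (@Fm t)).
    by apply: measurable_sum => k; exact: measurable_funM.
  - apply/measurable_EFinP; apply: (measurable_fun_g_sigma (sF t) (@Fm t)).
    exact: measurable_funD.
  - by move=> w _; rewrite lee_fin.
pose V t := (\int[P]_w (sqnorm (x t w - xs))%:E + \int[P]_w (Y t w)%:E +
  (M t)%:E)%E.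
have V0 t : (0 <= V t)%E.
  apply: adde_ge0; last by rewrite lee_fin.
  by apply: adde_ge0; apply: integral_ge0 => w _; rewrite lee_fin ?sqnorm_ge0.
have descent t : (V t.+1 + (omega * eta)%:E * \int[P]_w (D t w)%:E <= V t)%E.
  rewrite /V; apply: le_trans (_ : \int[P]_w (W t w)%:E + \int[P]_w (Y t w)%:E +
    (M t.+1)%:E + (omega * eta)%:E * \int[P]_w (D t w)%:E <= _)%E.
    by rewrite !leeD2r.
  rewrite [leRHS]addeAC [X in (X + _ <= _)%E]addeAC [leLHS]addeAC.
  exact: leeD2r (hA t).
have c0 : 0 < omega * eta by rewrite mulr_gt0.
(* Telescoping without subtraction: the accumulated decrease stays on the left. *)
have total n : (V n + \sum_(t < n) (omega * eta)%:E * \int[P]_w (D t w)%:E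
    <= V 0%N)%E.
  elim: n => [|n IH]; first by rewrite big_ord0 adde0.
  apply: le_trans IH; rewrite big_ord_recr /= [X in (_ + X)%E]addeC addeA.
  exact: leeD2r.
have intc (r : R) : (\int[P]_w r%:E = r%:E)%E.
  by rewrite -[RHS]mule1 -(probability_setT P); exact: integral_cst.
(* The deterministic start makes [H 0] constant, so its value at the arbitrary outcome [point] gives
   a finite initial potential. *)
have V0fin : V 0%N = (H 0%N point + M 0%N)%:E.
  have Hpt w : (x 0%N w = x 0%N point) * (Y 0%N w = Y 0%N point).
    by split; [rewrite !hx0|apply: eq_bigr => k _; rewrite !hy0].
  rewrite /V; under eq_integral do rewrite Hpt.
  under [X in (_ + X + _)%E]eq_integral do rewrite Hpt.
  by rewrite !intc -!EFinD.
apply: (@ae_cvg0_of_sum_integral_le _ _ _ P D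
  ((H 0%N point + M 0%N) / (omega * eta))).
- by move=> t; apply: (measurable_fun_g_sigma (sF t) (@Fm t)).
- by [].
(* Dropping [V n >= 0] from [total] and dividing by [omega * eta] gives a bound uniform in [n]. *)
move=> n; rewrite EFinM lee_pdivlMr // muleC -V0fin.
apply: le_trans (total n); rewrite ge0_sume_distrr.
  by rewrite leeDr.
by move=> t _; apply: integral_ge0 => w _; rewrite lee_fin.
Qed.
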